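(* Let $k>1$. The image of $\theta_k:\mathcal P_k\hookrightarrow\mathcal A$ is the set $$\theta_k(\mathcal P_k)=\left\{R^\ddagger_{k^y,Y}R_{k^x,X} : Y<k^y,\ X<k^x\right\}\subseteq\mathcal I(\mathbb N),$$ where $x,y,X,Y$ range over $\mathbb N$.
   Context: $\mathbb N=\{0,1,2,\dots\}$. $\mathcal I(\mathbb N)$ is the symmetric inverse monoid on $\mathbb N$: all partial injections $\mathbb N\to\mathbb N$ under composition of partial functions ($fg$ means first $g$, then $f$), with generalised inverse $f^\ddagger(y)=x$ iff $f(x)=y$; its zero $\epsilon$ is the nowhere-defined partial function. For $a>b\in\mathbb N$, $R_{a,b}\in\mathcal I(\mathbb N)$ has domain $\{an+b:n\in\mathbb N\}$ and $R_{a,b}(n)=\frac{n-b}{a}$ there. $\mathcal A$ is the inverse subsemigroup of $\mathcal I(\mathbb N)$ generated by all $R_{a,b}$, $a>b\in\mathbb N$. $\mathcal P_k$ (the $k$-th polycyclic monoid) is the inverse monoid generated by $\{0,\dots,k-1\}$ subject to the relations $xy^\ddagger=Id$ if $x=y$ and $xy^\ddagger=\epsilon$ (the zero element) if $x\neq y$; $\theta_k$ is the injective inverse monoid homomorphism with $\theta_k(x)=R_{k,x}$ for $0\le x<k$.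
   Formalization: The zero element ε is added to the displayed set: the image contains ε = R_{k,0}R_{k,1}^‡, whereas every R^‡_{k^y,Y}R_{k^x,X} sends X to Y and so is non-empty, so the equality as printed fails exactly at ε. *)

(* Defs.v *)
From HB Require Import structures.
From mathcomp Require Import all_boot.
From mathcomp Require Import all_classical.

Set Implicit Arguments.
Unset Strict Implicit.
Unset Printing Implicit Defensive.

Local Open Scope group_scope.

(* Inverse monoids with zero, as a variety: by a classical result, the two
   axioms [mulgVK] and [mulg_projC] on top of an involutive anti-automorphism
   say exactly that x^-1 is the unique generalised inverse of x.  The operation
   written x^-1 is thus the generalised inverse (dagger), not a group inverse. *)
HB.mixin Record StarMonoid_isInverseMonoid0 M of StarMonoid M := {
  imzero : M;
  mul0g : forall x : M, imzero * x = imzero;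
  mulg0 : forall x : M, x * imzero = imzero;
  mulgVK : forall x : M, x * x^-1 * x = x;
  mulg_projC : forall x y : M,
    (x * x^-1) * (y * y^-1) = (y * y^-1) * (x * x^-1)
}.

#[short(type="inverseMonoid0Type")]
HB.structure Definition InverseMonoid0 :=
  { M of StarMonoid_isInverseMonoid0 M & StarMonoid M }.

(* A partial injection is given by its graph: [pgraph f x y] means that f is
   defined at x and f(x) = y. *)
Record pinj := PInj {
  pgraph :> nat -> nat -> Prop;
  pgraph_fun : forall x y z, pgraph x y -> pgraph x z -> y = z;
  pgraph_inj : forall x y z, pgraph x z -> pgraph y z -> x = y
}.

Lemma pinjP (f g : pinj) : (forall x y, f x y <-> g x y) -> f = g.
Proof.
case: f g => [f f1 f2] [g g1 g2] /= fg.
have {}fg : f = g by apply/funext => x; apply/funext => y; apply/propext.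
by rewrite -{}fg in g1 g2 *; congr PInj; exact: Prop_irrelevance.
Qed.

HB.instance Definition _ := gen_eqMixin pinj.
HB.instance Definition _ := gen_choiceMixin pinj.

Lemma pmul_fun (f g : pinj) x y z :
  (exists2 t, g x t & f t y) -> (exists2 t, g x t & f t z) -> y = z.
Proof.
move=> [t xt ty] [s xs sz]; rewrite (pgraph_fun xs xt) in sz.
exact: (pgraph_fun ty sz).
Qed.

Lemma pmul_inj (f g : pinj) x y z :
  (exists2 t, g x t & f t z) -> (exists2 t, g y t & f t z) -> x = y.
Proof.
move=> [t xt tz] [s ys sz]; rewrite (pgraph_inj sz tz) in ys.
exact: (pgraph_inj xt ys).
Qed.

(* fg is first g, then f. *)
Definition pmul (f g : pinj) : pinj := PInj (@pmul_fun f g) (@pmul_inj f g).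

Definition pone : pinj :=
  @PInj (fun x y => x = y)
    (fun x y z xy xz => etrans (esym xy) xz)
    (fun x y z xz yz => etrans xz (esym yz)).

Definition pinv (f : pinj) : pinj :=
  @PInj (fun y x => f x y)
    (fun x y z xy xz => pgraph_inj xy xz)
    (fun x y z xz yz => pgraph_fun xz yz).

Definition pzero : pinj :=
  @PInj (fun _ _ => False) (fun x y z xy => False_ind _ xy)
    (fun x y z xz => False_ind _ xz).

Lemma pmulA : associative pmul.
Proof.
move=> f g h; apply: pinjP => x y; split.
  by move=> [t [s xs st] ty]; exists s => //; exists t.
by move=> [s xs [t st ty]]; exists t => //; exists s.
Qed.

Lemma pmul1 : left_id pone pmul.
Proof.
move=> f; apply: pinjP => x y; split=> [[t xt <-//]|xy].
by exists y.
Qed.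

Lemma pinvK : involutive pinv.
Proof. by move=> f; apply: pinjP. Qed.

Lemma pinvM : {morph pinv : f g / pmul f g >-> pmul g f}.
Proof. by move=> f g; apply: pinjP => x y; split=> -[t ? ?]; exists t. Qed.

HB.instance Definition _ := isStarMonoid.Build pinj pmulA pmul1 pinvK pinvM.

Lemma pmul0 (f : pinj) : pzero * f = pzero.
Proof. by apply: pinjP => x y; split=> // -[]. Qed.

Lemma pmulr0 (f : pinj) : f * pzero = pzero.
Proof. by apply: pinjP => x y; split=> // -[]. Qed.

Lemma pmulVK (f : pinj) : f * f^-1 * f = f.
Proof.
apply: pinjP => x y; split.
  by move=> [t xt [s ts sy]]; rewrite (pgraph_inj xt ts).
by move=> xy; exists y => //; exists x.
Qed.

Lemma pmul_projE (f : pinj) x y :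
  (f * f^-1)%g x y <-> x = y /\ exists t, f t x.
Proof.
split=> [[t tx ty]|[<- [t tx]]]; last by exists t.
by split; [exact: (@pgraph_fun f t)|exists t].
Qed.

Lemma pmul_projC (f g : pinj) :
  (f * f^-1) * (g * g^-1) = (g * g^-1) * (f * f^-1).
Proof.
apply: pinjP => x y; split=> -[t /pmul_projE[<- ex] /pmul_projE[<- ex']];
  by exists x; apply/pmul_projE.
Qed.

HB.instance Definition _ :=
  StarMonoid_isInverseMonoid0.Build pinj pmul0 pmulr0 pmulVK pmul_projC.

Lemma Rab_fun a b (ba : (b < a)%N) x y z :
  x = (a * y + b)%N -> x = (a * z + b)%N -> y = z.
Proof.
move=> -> /eqP; rewrite eqn_add2r eqn_pmul2l ?(leq_ltn_trans _ ba)//.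
by move/eqP.
Qed.

(* The graph of R_{a,b} is {(a n + b, n) : n in N}. *)
Definition Rab a b (ba : (b < a)%N) : pinj :=
  @PInj (fun x n => x = (a * n + b)%N) (@Rab_fun a b ba)
    (fun x y z xz yz => etrans xz (esym yz)).

Inductive in_calA : pinj -> Prop :=
| in_calA_R a b (ba : (b < a)%N) : in_calA (Rab ba)
| in_calA_mul f g : in_calA f -> in_calA g -> in_calA (f * g)
| in_calA_inv f : in_calA f -> in_calA f^-1.

Definition calA := {f : pinj | `[< in_calA f >]}.

HB.instance Definition _ := SubChoice.on calA.

Lemma RabK a b (ba : (b < a)%N) : Rab ba * (Rab ba)^-1 = 1.
Proof.
apply: pinjP => x y; split=> [[t -> tE]|<-].
  exact: (Rab_fun ba erefl tE).
by exists (a * x + b)%N.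
Qed.

Lemma Rab0 a b c (ba : (b < a)%N) (ca : (c < a)%N) :
  b <> c -> Rab ba * (Rab ca)^-1 = imzero.
Proof.
move=> bc; apply: pinjP => x y; split=> //= -[t /= -> /(congr1 (modn^~ a))].
by rewrite ![(a * _)%N]mulnC !modnMDl !modn_small// => cb; apply: bc.
Qed.

Lemma in_calA1 : in_calA 1.
Proof.
by rewrite -(RabK (ltn0Sn 0)); do !constructor.
Qed.

Lemma in_calA0 : in_calA imzero.
Proof.
have /= <- : Rab (ltn0Sn 1) * (Rab (ltnSn 1))^-1 = imzero by exact: Rab0.
by do !constructor.
Qed.

Lemma calA_monoid_closed :
  monoid_closed (fun f : pinj => `[< in_calA f >]).
Proof.
split=> [|f g /asboolP Af /asboolP Ag]; apply/asboolP; first exact: in_calA1.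
exact: in_calA_mul.
Qed.

HB.instance Definition _ :=
  SubChoice_isSubMonoid.Build pinj _ calA calA_monoid_closed.

Definition calA_of (f : pinj) (Af : in_calA f) : calA := exist _ f (asboolT Af).

Lemma in_calA_val (f : calA) : in_calA (val f).
Proof. exact/asboolP/(valP f). Qed.

Definition calA_inv (f : calA) : calA := calA_of (in_calA_inv (in_calA_val f)).

HB.instance Definition _ := hasInv.Build calA calA_inv.

Lemma calA_invK : involutive calA_inv.
Proof. by move=> f; apply: val_inj; rewrite /= invgK. Qed.

Lemma calA_invM : {morph calA_inv : f g / f * g >-> g * f}.
Proof. by move=> f g; apply: val_inj; rewrite /= invgM. Qed.

HB.instance Definition _ :=
  Monoid_isStarMonoid.Build calA calA_invK calA_invM.

Definition calA0 : calA := calA_of in_calA0.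

Lemma calA_mul0 (f : calA) : calA0 * f = calA0.
Proof. by apply: val_inj; rewrite gmulfM; exact: mul0g. Qed.

Lemma calA_mulr0 (f : calA) : f * calA0 = calA0.
Proof. by apply: val_inj; rewrite gmulfM; exact: mulg0. Qed.

Lemma calA_mulVK (f : calA) : f * f^-1 * f = f.
Proof. by apply: val_inj; rewrite !gmulfM; exact: mulgVK. Qed.

Lemma calA_projC (f g : calA) :
  (f * f^-1) * (g * g^-1) = (g * g^-1) * (f * f^-1).
Proof. by apply: val_inj; rewrite !gmulfM; exact: mulg_projC. Qed.

HB.instance Definition _ :=
  StarMonoid_isInverseMonoid0.Build calA
    calA_mul0 calA_mulr0 calA_mulVK calA_projC.

(* The polycyclic monoid P_k is the quotient of the algebra of terms over the
   generators 0, ..., k-1 by the least congruence [polycyclic_eq] containing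
   the laws of inverse monoids with zero and the defining relations. *)
Inductive pterm (k : nat) : Type :=
| PGen of 'I_k
| POne
| PZero
| PMul of pterm k & pterm k
| PInv of pterm k.

Arguments POne {k}.
Arguments PZero {k}.

Inductive polycyclic_eq (k : nat) : pterm k -> pterm k -> Prop :=
| pe_refl s : polycyclic_eq s s
| pe_sym s t : polycyclic_eq s t -> polycyclic_eq t s
| pe_trans s t u : polycyclic_eq s t -> polycyclic_eq t u -> polycyclic_eq s u
| pe_mul s s' t t' : polycyclic_eq s s' -> polycyclic_eq t t' ->
    polycyclic_eq (PMul s t) (PMul s' t')
| pe_inv s s' : polycyclic_eq s s' -> polycyclic_eq (PInv s) (PInv s')
| pe_mulA s t u :
    polycyclic_eq (PMul s (PMul t u)) (PMul (PMul s t) u)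
| pe_mul1 s : polycyclic_eq (PMul POne s) s
| pe_mulr1 s : polycyclic_eq (PMul s POne) s
| pe_mul0 s : polycyclic_eq (PMul PZero s) PZero
| pe_mulr0 s : polycyclic_eq (PMul s PZero) PZero
| pe_invK s : polycyclic_eq (PInv (PInv s)) s
| pe_invM s t : polycyclic_eq (PInv (PMul s t)) (PMul (PInv t) (PInv s))
| pe_mulVK s : polycyclic_eq (PMul (PMul s (PInv s)) s) s
| pe_projC s t : polycyclic_eq
    (PMul (PMul s (PInv s)) (PMul t (PInv t)))
    (PMul (PMul t (PInv t)) (PMul s (PInv s)))
| pe_gen_eq (x : 'I_k) : polycyclic_eq (PMul (PGen x) (PInv (PGen x))) POne
| pe_gen_neq (x y : 'I_k) : x <> y ->
    polycyclic_eq (PMul (PGen x) (PInv (PGen y))) PZero.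

HB.instance Definition _ k := gen_eqMixin (pterm k).
HB.instance Definition _ k := gen_choiceMixin (pterm k).

Section Polycyclic.
Variable k : nat.

Definition polycyclic_rel (s t : pterm k) : bool := `[< polycyclic_eq s t >].

Lemma polycyclic_rel_refl : reflexive polycyclic_rel.
Proof. by move=> s; apply/asboolP; exact: pe_refl. Qed.

Lemma polycyclic_rel_sym : symmetric polycyclic_rel.
Proof. by move=> s t; apply/asboolP/asboolP; exact: pe_sym. Qed.

Lemma polycyclic_rel_trans : transitive polycyclic_rel.
Proof.
by move=> t s u /asboolP st /asboolP tu; apply/asboolP; exact: pe_trans st tu.
Qed.

Canonical polycyclic_equiv := EquivRel polycyclic_rel
  polycyclic_rel_refl polycyclic_rel_sym polycyclic_rel_trans.

Definition polycyclic := {eq_quot polycyclic_equiv}%qT.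

HB.instance Definition _ := Choice.on polycyclic.

Definition pc_class (s : pterm k) : polycyclic := (\pi_polycyclic s)%qT.

Lemma pc_classP s t : pc_class s = pc_class t <-> polycyclic_eq s t.
Proof. by split=> [/eqmodP/asboolP|st]//; apply/eqmodP/asboolP. Qed.

Lemma pc_classK p : pc_class (repr p) = p.
Proof. exact: reprK. Qed.

Lemma repr_pc_class s : polycyclic_eq (repr (pc_class s)) s.
Proof. by apply/pc_classP; rewrite pc_classK. Qed.

Lemma pc_classW (P : polycyclic -> Prop) :
  (forall s, P (pc_class s)) -> forall p, P p.
Proof. by move=> Ps p; rewrite -(pc_classK p). Qed.

Definition pc_mul (p q : polycyclic) := pc_class (PMul (repr p) (repr q)).
Definition pc_inv (p : polycyclic) := pc_class (PInv (repr p)).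
Definition pc_gen (x : 'I_k) : polycyclic := pc_class (PGen x).

Lemma pc_mulE s t : pc_mul (pc_class s) (pc_class t) = pc_class (PMul s t).
Proof. by apply/pc_classP/pe_mul; exact: repr_pc_class. Qed.

Lemma pc_invE s : pc_inv (pc_class s) = pc_class (PInv s).
Proof. by apply/pc_classP/pe_inv; exact: repr_pc_class. Qed.

Lemma pc_mulA : associative pc_mul.
Proof.
elim/pc_classW=> s; elim/pc_classW=> t; elim/pc_classW=> u.
by rewrite !pc_mulE; apply/pc_classP; exact: pe_mulA.
Qed.

Lemma pc_mul1 : left_id (pc_class POne) pc_mul.
Proof. by elim/pc_classW=> s; rewrite pc_mulE; apply/pc_classP/pe_mul1. Qed.

Lemma pc_invK : involutive pc_inv.
Proof. by elim/pc_classW=> s; rewrite !pc_invE; apply/pc_classP/pe_invK. Qed.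

Lemma pc_invM : {morph pc_inv : p q / pc_mul p q >-> pc_mul q p}.
Proof.
elim/pc_classW=> s; elim/pc_classW=> t.
by rewrite !(pc_mulE, pc_invE); apply/pc_classP/pe_invM.
Qed.

HB.instance Definition _ :=
  isStarMonoid.Build polycyclic pc_mulA pc_mul1 pc_invK pc_invM.

Lemma pc_mul0 (p : polycyclic) : pc_class PZero * p = pc_class PZero.
Proof.
elim/pc_classW: p => s; rewrite [LHS]pc_mulE; exact/pc_classP/pe_mul0.
Qed.

Lemma pc_mulr0 (p : polycyclic) : p * pc_class PZero = pc_class PZero.
Proof.
elim/pc_classW: p => s; rewrite [LHS]pc_mulE; exact/pc_classP/pe_mulr0.
Qed.

Lemma pc_mulVK (p : polycyclic) : p * p^-1 * p = p.
Proof.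
rewrite -[LHS]/(pc_mul (pc_mul p (pc_inv p)) p).
by elim/pc_classW: p => s; rewrite !(pc_mulE, pc_invE); apply/pc_classP/pe_mulVK.
Qed.

Lemma pc_projC (p q : polycyclic) :
  (p * p^-1) * (q * q^-1) = (q * q^-1) * (p * p^-1).
Proof.
rewrite -[LHS]/(pc_mul (pc_mul p (pc_inv p)) (pc_mul q (pc_inv q))).
rewrite -[RHS]/(pc_mul (pc_mul q (pc_inv q)) (pc_mul p (pc_inv p))).
elim/pc_classW: p => s; elim/pc_classW: q => t.
by rewrite !(pc_mulE, pc_invE); apply/pc_classP/pe_projC.
Qed.

HB.instance Definition _ :=
  StarMonoid_isInverseMonoid0.Build polycyclic
    pc_mul0 pc_mulr0 pc_mulVK pc_projC.

Lemma pc_gen_eq (x : 'I_k) : pc_gen x * (pc_gen x)^-1 = 1.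
Proof.
rewrite -[LHS]/(pc_mul (pc_gen x) (pc_inv (pc_gen x))) pc_invE pc_mulE.
exact/pc_classP/pe_gen_eq.
Qed.

Lemma pc_gen_neq (x y : 'I_k) :
  x <> y -> pc_gen x * (pc_gen y)^-1 = imzero.
Proof.
move=> xy; rewrite -[LHS]/(pc_mul (pc_gen x) (pc_inv (pc_gen y))).
by rewrite pc_invE pc_mulE; apply/pc_classP/pe_gen_neq.
Qed.

Section Lift.
Variables (M : inverseMonoid0Type) (f : 'I_k -> M).
Hypothesis f_eq : forall x, f x * (f x)^-1 = 1.
Hypothesis f_neq : forall x y, x <> y -> f x * (f y)^-1 = imzero.

Fixpoint pterm_eval (s : pterm k) : M :=
  match s with
  | PGen x => f x
  | POne => 1
  | PZero => imzero
  | PMul s t => pterm_eval s * pterm_eval t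
  | PInv s => (pterm_eval s)^-1
  end.

Lemma pterm_evalP s t :
  polycyclic_eq s t -> pterm_eval s = pterm_eval t.
Proof.
elim=> {s t} //=.
- by move=> s t u _ -> _ ->.
- by move=> s s' t t' _ -> _ ->.
- by move=> s s' _ ->.
- by move=> s t u; rewrite mulgA.
- by move=> s; rewrite mul1g.
- by move=> s; rewrite mulg1.
- by move=> s; rewrite mul0g.
- by move=> s; rewrite mulg0.
- by move=> s; rewrite invgK.
- by move=> s t; rewrite invgM.
- by move=> s; rewrite mulgVK.
- by move=> s t; rewrite mulg_projC.
Qed.

Definition pc_lift (p : polycyclic) : M := pterm_eval (repr p).

Lemma pc_liftE s : pc_lift (pc_class s) = pterm_eval s.
Proof. exact/pterm_evalP/repr_pc_class. Qed.

Lemma pc_lift_gen x : pc_lift (pc_gen x) = f x.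
Proof. exact: pc_liftE. Qed.

Lemma pc_lift1 : pc_lift 1 = 1.
Proof. exact: pc_liftE. Qed.

Lemma pc_lift0 : pc_lift imzero = imzero.
Proof. exact: pc_liftE. Qed.

Lemma pc_liftM : {morph pc_lift : p q / p * q}.
Proof. by move=> p q; rewrite [LHS]pc_liftE. Qed.

Lemma pc_liftV : {morph pc_lift : p / p^-1}.
Proof. by move=> p; rewrite [LHS]pc_liftE. Qed.

End Lift.
End Polycyclic.

Section Theta.
Variable k : nat.

Definition calA_R (x : 'I_k) : calA := calA_of (in_calA_R (ltn_ord x)).

Lemma calA_R_eq x : calA_R x * (calA_R x)^-1 = 1.
Proof. by apply: val_inj; rewrite gmulfM; exact: RabK. Qed.

Lemma calA_R_neq x y : x <> y -> calA_R x * (calA_R y)^-1 = imzero.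
Proof.
move=> xy; apply: val_inj; rewrite gmulfM; apply: Rab0 => /val_inj; exact: xy.
Qed.

(* theta_k is induced on the quotient by x |-> R_{k,x}. *)
Definition theta : polycyclic k -> calA := pc_lift calA_R.

Lemma theta_gen x : theta (pc_gen x) = calA_R x.
Proof. exact: (pc_lift_gen calA_R_eq calA_R_neq). Qed.

Lemma theta1 : theta 1 = 1.
Proof. exact: (pc_lift1 calA_R_eq calA_R_neq). Qed.

Lemma theta0 : theta imzero = imzero.
Proof. exact: (pc_lift0 calA_R_eq calA_R_neq). Qed.

Lemma thetaM : {morph theta : p q / p * q}.
Proof. exact: (pc_liftM calA_R_eq calA_R_neq). Qed.

Lemma thetaV : {morph theta : p / p^-1}.
Proof. exact: (pc_liftV calA_R_eq calA_R_neq). Qed.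

End Theta.

Arguments theta k p : clear implicits.

(* Main.v *)
Require Import Defs.
From mathcomp Require Import all_boot.
From mathcomp Require Import all_classical.

(** Since [R_{a,b} R_{c,d} = R_{ca,cb+d}], the maps [R_{k^x,X}] with [X < k^x]
    are exactly the products of the generators [R_{k,i}] (read off the base-k
    digits of [X]).  A product [R_{k^y,Y} R_{k^x,X}^-1] with [y <= x] is
    simplified by factoring [R_{k^x,X} = R_{k^(x-y),q} R_{k^y,r}] through the
    Euclidean division of [X] by [k^y]: it is [0] or [R_{k^(x-y),q}^-1].  Hence
    the right-hand side is closed under products and inverses. *)

Set Implicit Arguments.
Unset Strict Implicit.

Local Open Scope classical_set_scope.

(** The proof of the bound does not enter the graph, so equal numerical parameters suffice; this
    allows passing between forms such as [k ^ 1] and [k]. *)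
Lemma Rab_eq a b c d (ba : (b < a)%N) (dc : (d < c)%N) :
  a = c -> b = d -> Rab ba = Rab dc.
Proof. by move=> ac bd; apply: pinjP => u v /=; rewrite ac bd. Qed.

Lemma RabM a b c d (ba : (b < a)%N) (dc : (d < c)%N)
    (lt : (c * b + d < c * a)%N) :
  (Rab ba * Rab dc)%g = Rab lt.
Proof.
apply: pinjP => u v; split=> /= [[t /= -> ->]|->].
  by rewrite mulnDr mulnA addnA.
by exists (a * v + b)%N => //=; rewrite mulnDr mulnA addnA.
Qed.

Lemma RabM_lt a b c d : (b < a)%N -> (d < c)%N -> (c * b + d < c * a)%N.
Proof.
move=> ba dc; apply: (@leq_trans (c * b.+1)); last by rewrite leq_mul2l ba orbT.
by rewrite mulnS [leqRHS]addnC ltn_add2l.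
Qed.

Lemma imzeroV (M : inverseMonoid0Type) : (imzero : M)^-1%g = imzero.
Proof. by rewrite -(Defs.mulgVK (imzero^-1)%g) invgK mulg0 mul0g. Qed.

Section PowersOfk.
Variables (k : nat) (k_gt0 : (0 < k)%N).

Lemma Rab_expM x X y Y (Xx : (X < k ^ x)%N) (Yy : (Y < k ^ y)%N) :
  exists z Z (Zz : (Z < k ^ z)%N), (Rab Xx * Rab Yy)%g = Rab Zz.
Proof.
have lt := RabM_lt Xx Yy; rewrite (RabM _ _ lt).
have lt' := lt; rewrite -expnD in lt'.
by exists (y + x)%N, (k ^ y * X + Y)%N, lt'; apply: Rab_eq; rewrite // expnD.
Qed.

Lemma Rab_exp_factor x y X (Xxy : (X < k ^ (y + x))%N)
    (qx : (X %/ k ^ y < k ^ x)%N) (ry : (X %% k ^ y < k ^ y)%N) :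
  Rab Xxy = (Rab qx * Rab ry)%g.
Proof.
rewrite (RabM _ _ (RabM_lt qx ry)); apply: Rab_eq; first by rewrite expnD.
by rewrite mulnC -divn_eq.
Qed.

Lemma Rab_exp_mulV_le y Y x X (Yy : (Y < k ^ y)%N) (Xx : (X < k ^ x)%N) :
  (y <= x)%N ->
  (Rab Yy * (Rab Xx)^-1)%g = imzero \/
  exists z Z (Zz : (Z < k ^ z)%N), (Rab Yy * (Rab Xx)^-1)%g = (Rab Zz)^-1%g.
Proof.
move=> /subnKC; move: (x - y)%N => d dE; rewrite -{x}dE in Xx *.
have ry : (X %% k ^ y < k ^ y)%N by rewrite ltn_mod expn_gt0 k_gt0.
have qd : (X %/ k ^ y < k ^ d)%N.
  by rewrite ltn_divLR ?expn_gt0 ?k_gt0// mulnC -expnD.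
rewrite (Rab_exp_factor _ qd ry) invgM mulgA.
(* The two leftmost factors now share the modulus [k ^ y]: they cancel when the residues agree and
   annihilate otherwise. *)
have [YE|/eqP Yr] := eqVneq Y (X %% k ^ y)%N.
  right; exists d, (X %/ k ^ y)%N, qd.
  by rewrite (Rab_eq Yy ry erefl YE) RabK mul1g.
by left; rewrite Rab0// mul0g.
Qed.

(** Such a map sends [k ^ x * n + X] to [k ^ y * n + Y], so it is never empty; zero is therefore a
    separate alternative below. *)
Definition poly_form (f : pinj) : Prop :=
  exists (x y X Y : nat) (Yy : (Y < k ^ y)%N) (Xx : (X < k ^ x)%N),
    f = ((Rab Yy)^-1 * Rab Xx)%g.

Lemma poly_formV (f : pinj) : poly_form f -> poly_form f^-1%g.
Proof.
move=> [x [y [X [Y [Yy [Xx ->]]]]]].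
by exists y, x, Y, X, Xx, Yy; rewrite invgM invgK.
Qed.

Lemma poly_formM_le x y X Y (Yy : (Y < k ^ y)%N) (Xx : (X < k ^ x)%N)
    x' y' X' Y' (Yy' : (Y' < k ^ y')%N) (Xx' : (X' < k ^ x')%N)
    (f := ((Rab Yy)^-1 * Rab Xx)%g) (g := ((Rab Yy')^-1 * Rab Xx')%g) :
  (x <= y')%N -> (f * g)%g = imzero \/ poly_form (f * g)%g.
Proof.
move=> xy'; rewrite /f /g -mulgA [(Rab Xx * _)%g]mulgA.
have [->|[z [Z [Zz ->]]]] := Rab_exp_mulV_le Xx Yy' xy'.
  by left; rewrite mul0g mulg0.
(* The surviving inverse merges with the outer inverse on its left, as the inverse of one product of
   two maps. *)
right; rewrite mulgA -invgM; have [w [W [Ww ->]]] := Rab_expM Zz Yy.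
by exists x', w, X', W, Ww, Xx'.
Qed.

Lemma poly_formM (f g : pinj) : poly_form f -> poly_form g ->
  (f * g)%g = imzero \/ poly_form (f * g)%g.
Proof.
move=> [x [y [X [Y [Yy [Xx ->]]]]]] [x' [y' [X' [Y' [Yy' [Xx' ->]]]]]].
have [xy'|/ltnW y'x] := leqP x y'; first exact: poly_formM_le.
(* Taking inverses exchanges the two inner factors. *)
rewrite -[(_ * _ * _)%g]invgK invgM.
rewrite [((Rab Yy)^-1 * _)^-1%g]invgM [((Rab Yy')^-1 * _)^-1%g]invgM !invgK.
have [->|/poly_formV] := poly_formM_le Xx' Yy' Xx Yy y'x; last by right.
by left; rewrite imzeroV.
Qed.

Lemma poly_form_Rab x X (Xx : (X < k ^ x)%N) : poly_form (Rab Xx).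
Proof.
have lt01 : (0 < k ^ 0)%N by [].
(* The left factor is [R_{1,0}], the identity. *)
exists x, 0, X, 0, lt01, Xx; apply: pinjP => u v; split=> [uv|[t /= -> ->]].
  by exists v => //=; rewrite mul1n addn0.
by rewrite mul1n addn0.
Qed.

Lemma poly_form1 : poly_form 1%g.
Proof.
have lt01 : (0 < k ^ 0)%N by [].
suff -> : 1%g = Rab lt01 by exact: poly_form_Rab.
by apply: pinjP => u v /=; rewrite mul1n addn0.
Qed.

Lemma poly_form_theta p : val (theta k p) = imzero \/ poly_form (val (theta k p)).
Proof.
(* On a class, [theta] evaluates any representing term, so structural induction on the term
   applies. *)
elim/pc_classW: p => s; rewrite /theta (pc_liftE (@calA_R_eq k) (@calA_R_neq k)).
elim: s => [i|||s [IHs|IHs] t [IHt|IHt]|s [IHs|IHs]] /=.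
- right; have ik : (i < k ^ 1)%N by rewrite expn1.
  by rewrite (Rab_eq _ ik) ?expn1//; exact: poly_form_Rab.
- by right; exact: poly_form1.
- by left.
- by left; rewrite /= in IHs *; rewrite IHs mul0g.
- by left; rewrite /= in IHs *; rewrite IHs mul0g.
- by left; rewrite /= in IHt *; rewrite IHt mulg0.
- exact: poly_formM.
- by left; rewrite /= in IHs *; rewrite IHs imzeroV.
- by right; exact: poly_formV.
Qed.

(** Induction on the number of base-k digits: the last digit of [X] gives the rightmost
    generator. *)
Lemma Rab_exp_theta x X (Xx : (X < k ^ x)%N) :
  exists p, val (theta k p) = Rab Xx.
Proof.
elim: x => [|x IHx] in X Xx *.
  exists 1%g; rewrite theta1; apply: pinjP => u v /=.
  (* With no digits left, [X] is 0 and the map is [R_{1,0}], the image of the empty product. *)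
  by move: Xx; rewrite expn0 ltnS leqn0 => /eqP ->; rewrite mul1n addn0.
have qx : (X %/ k ^ 1 < k ^ x)%N by rewrite expn1 ltn_divLR// mulnC -expnS.
have r1 : (X %% k ^ 1 < k ^ 1)%N by rewrite expn1 ltn_mod.
have rk : (X %% k < k)%N by rewrite ltn_mod.
have [p pE] := IHx _ qx; exists (p * pc_gen (Ordinal rk))%g.
rewrite (@Rab_exp_factor x 1 X Xx qx r1) -pE thetaM theta_gen [LHS]gmulfM.
by congr (_ * _)%g; apply: Rab_eq; rewrite expn1.
Qed.

End PowersOfk.

Unset Implicit Arguments.
Set Strict Implicit.

Theorem corollary36 (k : nat) (k_gt1 : (1 < k)%N) :
  [set val (theta k p) | p in [set: polycyclic k]] =
  [set f : pinj |
    exists (x y X Y : nat) (Y_lt : (Y < k ^ y)%N) (X_lt : (X < k ^ x)%N),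
      f = ((@Rab (k ^ y) Y Y_lt)^-1 * @Rab (k ^ x) X X_lt)%g]
  `|` [set imzero].
Proof.
have k_gt0 := ltnW k_gt1.
apply/seteqP; split=> [_ [p _ <-]|f [|->]].
- by have [->|] := poly_form_theta k_gt0 p; [right|left].
- move=> [x [y [X [Y [Yy [Xx ->]]]]]].
  have [p pE] := Rab_exp_theta k_gt0 Yy.
  have [q qE] := Rab_exp_theta k_gt0 Xx.
  by exists (p^-1 * q)%g => //; rewrite -pE -qE thetaM thetaV gmulfM.
- by exists imzero => //; rewrite theta0.
Qed.
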